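(* Let $0<\beta\le 1$. On every instance of $k$BCP admitting a feasible solution, Algorithm 2 (defined in the context) outputs $k$ disjoint $st$-paths $Q_1,\dots,Q_k$ with $\sum_i d(Q_i)\le(1+\beta)D$ and $\sum_i c(Q_i)\le\max\{2,\,1+\ln\frac{1}{\beta}\}\,C$; i.e., Algorithm 2 is a bifactor $(1+\beta,\,\max\{2,1+\ln\frac1\beta\})$-approximation.
   Context: $k$BCP: given a directed graph $G=(V,E)$ with $n=|V|$, $m=|E|$, distinct $s,t\in V$, cost $c:E\to\mathbb{Z}^{+}$, delay $d:E\to\mathbb{Z}^{+}$, and $C,D\in\mathbb{Z}^{+}$, compute $k$ disjoint $st$-paths with $\sum_i c(P_i)\le C$ and $\sum_i d(P_i)\le D$; for a path or cycle $X$, $c(X)$, $d(X)$ denote sums over its edges. Algorithm 2: first compute, by Suurballe and Tarjan's min-sum algorithm, $k$ disjoint $st$-paths $P_1,\dots,P_k$ minimizing $\sum_i\sum_{e\in P_i}\left(\frac{c(e)}{C}+\frac{d(e)}{D}\right)$. Then repeat: (1) if $\sum_i d(P_i)\le(1+\beta)D$, return $P_1,\dots,P_k$; (2) form $\overline G$ from $G$ by reversing the direction of every edge of $P_1,\dots,P_k$, setting its cost to a fixed small $\epsilon$ with $0<\epsilon<\frac{1}{mnD}$ and its delay to the negative of its original delay; (3) compute a cycle $O$ in $\overline G$ with $c(O)\le C$ and $d(O)<0$ minimizing $\frac{d(O)}{c(O)}$ among such cycles; (4) replace the paths by the $k$ disjoint $st$-paths formed by the edges of $P_1,\dots,P_k$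 together with those of $O$, after deleting each pair consisting of a path edge and its reversed copy used by $O$.
   Formalization: In step (3) the test c(O) ≤ C counts reversed edges as cost 0 instead of ε (the ratio still uses ε): with ε counted, a cycle whose original edges cost exactly C is rejected and the algorithm can get stuck on a feasible instance. *)

(* Defs.v *)
From mathcomp Require Import all_boot all_order all_algebra.
From mathcomp Require Import reals exp.

Set Implicit Arguments.
Unset Strict Implicit.
Unset Printing Implicit Defensive.

Import Order.TTheory GRing.Theory Num.Theory.
Local Open Scope ring_scope.

Record kBCP := KBCP {
  vertex : finType;
  edges : {set vertex * vertex};
  source : vertex;
  target : vertex;
  cost : vertex * vertex -> nat;
  delay : vertex * vertex -> nat;
  npaths : nat;
  cost_bound : nat;
  delay_bound : nat;
  source_neq_target : source != target;
  cost_gt0 : forall e, e \in edges -> (0 < cost e)%N;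
  delay_gt0 : forall e, e \in edges -> (0 < delay e)%N;
  cost_bound_gt0 : (0 < cost_bound)%N;
  delay_bound_gt0 : (0 < delay_bound)%N
}.

(* A path is the sequence of its vertices after [source I]. *)
Definition stpath (I : kBCP) (p : seq (vertex I)) : bool :=
  [&& path (fun u v => (u, v) \in edges I) (source I) p,
      last (source I) p == target I & uniq (source I :: p)].

Definition path_edges (I : kBCP) (p : seq (vertex I)) :
    seq (vertex I * vertex I) :=
  zip (source I :: p) p.

Notation path_family I := ((npaths I).-tuple (seq (vertex I))).

(* Disjoint means edge-disjoint. *)
Definition disjoint_stpaths (I : kBCP) (P : path_family I) : Prop :=
  (forall i, stpath (tnth P i)) /\
  (forall i j, i != j ->
     [disjoint path_edges (tnth P i) & path_edges (tnth P j)]).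

Definition total_cost (I : kBCP) (P : path_family I) : nat :=
  (\sum_(i < npaths I) \sum_(e <- path_edges (tnth P i)) cost e)%N.

Definition total_delay (I : kBCP) (P : path_family I) : nat :=
  (\sum_(i < npaths I) \sum_(e <- path_edges (tnth P i)) delay e)%N.

Definition feasible (I : kBCP) (P : path_family I) : Prop :=
  [/\ disjoint_stpaths P, (total_cost P <= cost_bound I)%N
    & (total_delay P <= delay_bound I)%N].

Definition weight (R : realType) (I : kBCP) (P : path_family I) : R :=
  \sum_(i < npaths I) \sum_(e <- path_edges (tnth P i))
    ((cost e)%:R / (cost_bound I)%:R + (delay e)%:R / (delay_bound I)%:R).

Definition min_sum (R : realType) (I : kBCP) (P : path_family I) : Prop :=
  disjoint_stpaths P /\
  (forall P' : path_family I, disjoint_stpaths P' -> weight R P <= weight R P').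

Definition used_edges (I : kBCP) (P : path_family I) :
    {set vertex I * vertex I} :=
  [set e | [exists i, e \in path_edges (tnth P i)]].

(* The residual graph may have parallel edges (when it contains both (u, v)
   and the reversed copy of (v, u)), so each of its edges is named by the edge
   of the original graph that it comes from; membership in [used_edges P]
   says whether it is a reversed copy. *)
Definition res_tail (I : kBCP) (P : path_family I) (e : vertex I * vertex I) :=
  if e \in used_edges P then e.2 else e.1.

Definition res_head (I : kBCP) (P : path_family I) (e : vertex I * vertex I) :=
  if e \in used_edges P then e.1 else e.2.

Definition res_cost (R : realType) (I : kBCP) (eps : R) (P : path_family I)
    (O : seq (vertex I * vertex I)) : R :=
  \sum_(e <- O) (if e \in used_edges P then eps else (cost e)%:R).

Definition res_delay (R : realType) (I : kBCP) (P : path_family I)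
    (O : seq (vertex I * vertex I)) : R :=
  \sum_(e <- O) (if e \in used_edges P then - (delay e)%:R else (delay e)%:R).

Definition res_cycle (I : kBCP) (P : path_family I)
    (O : seq (vertex I * vertex I)) : bool :=
  [&& O != [::], all (mem (edges I)) O,
      cycle (fun e f => res_head P e == res_tail P f) O
    & uniq (map (res_tail P) O)].

(* Pitfall: the budget test c(O) <= C counts a reversed copy as 0; eps only
   enters the ratio d(O)/c(O), where it keeps the denominator positive.  Since
   costs are integers and a cycle has fewer than 1/eps edges, this test is
   equivalent to floor(res_cost eps P O) <= C.  With eps included in the test,
   a cycle whose original edges cost exactly C would be rejected, and the loop
   could get stuck: take k = 1, C = D = 10, beta = 1/2, an edge s -> t with
   (cost, delay) = (1, 16) and a path s -> a -> t with (5, 5) on both edges.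
   The min-sum path is the edge, of delay 16 > 15, and the only residual cycle
   has res_cost 10 + eps > C, although s -> a -> t is feasible. *)
Definition eligible_cycle (R : realType) (I : kBCP) (P : path_family I)
    (O : seq (vertex I * vertex I)) : Prop :=
  [/\ res_cycle P O, res_cost (0 : R) P O <= (cost_bound I)%:R
    & res_delay R P O < 0].

Definition best_cycle (R : realType) (I : kBCP) (eps : R) (P : path_family I)
    (O : seq (vertex I * vertex I)) : Prop :=
  eligible_cycle R P O /\
  (forall O', eligible_cycle R P O' ->
     res_delay R P O / res_cost eps P O
       <= res_delay R P O' / res_cost eps P O').

(* Edges of P and O left after deleting each pair formed by an edge of P and
   its reversed copy used by O. *)
Definition exchange_edges (I : kBCP) (P : path_family I)
    (O : seq (vertex I * vertex I)) : {set vertex I * vertex I} :=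
  (used_edges P :\: [set e in O]) :|: ([set e in O] :\: used_edges P).

(* [exchange_edges P O] carries k units of flow from s to t, but in general it
   decomposes into k disjoint st-paths plus some cycles, hence an inclusion. *)
Definition exchange (I : kBCP) (P : path_family I)
    (O : seq (vertex I * vertex I)) (P' : path_family I) : Prop :=
  disjoint_stpaths P' /\ used_edges P' \subset exchange_edges P O.

(* Total correctness of the loop started from P, whatever choices are made
   among best cycles and among path families formed from the exchanged edges:
   no step is ever stuck, the loop stops, and every returned family satisfies
   [Post]. *)
Inductive loop_returns (R : realType) (I : kBCP) (beta eps : R)
    (Post : path_family I -> Prop) (P : path_family I) : Prop :=
| LoopReturn of
    (total_delay P)%:R <= (1 + beta) * (delay_bound I)%:R
  & Post P
| LoopIterate of
    (1 + beta) * (delay_bound I)%:R < (total_delay P)%:R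
  & (exists O, best_cycle eps P O)
  & (forall O, best_cycle eps P O -> exists P', exchange P O P')
  & (forall O P', best_cycle eps P O -> exchange P O P' ->
       loop_returns beta eps Post P').

Definition algorithm2_returns (R : realType) (I : kBCP) (beta eps : R)
    (Post : path_family I -> Prop) : Prop :=
  (exists P : path_family I, min_sum R P) /\
  (forall P : path_family I, min_sum R P -> loop_returns beta eps Post P).

(* Main.v *)
(* Every residual cycle bought by the algorithm reduces the excess delay
   d(P) - D at least as efficiently as the average of the cycles into which
   the difference between P and a feasible solution decomposes. Hence a cycle
   of cost c multiplies y = (d(P) - D) / D by at most 1 - c / C', where
   C' = C + eps m, and the bound c(P) <= - C' ln y is preserved by every
   iteration; initially it follows from c(P) / C + d(P) / D <= 2 and
   ln y <= y - 1. When the loop stops the previous y exceeded beta and the last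
   cycle cost at most C. The error eps m ln (1 / y) is at most eps m D <= 1
   because y >= 1 / D by integrality, and it is paid for by the path edge,
   of cost at least 1, that the last cycle must have removed. *)
Require Import Defs.
From mathcomp Require Import all_boot all_order all_algebra.
From mathcomp Require Import boolp reals exp.
From mathcomp Require Import lra.
Import Order.TTheory GRing.Theory Num.Theory.
Local Open Scope ring_scope.

Set Implicit Arguments.
Unset Strict Implicit.
Unset Printing Implicit Defensive.

(** * Sums over symmetric differences, and minimization *)

(** With [A] the edges in use, the second sum follows the sign rule of the residual graph, so one
    identity handles net flow, delay and cost after toggling [B]. *)
Lemma sum_symdiff (T : finType) (M : zmodType) (F : T -> M) (A B : {set T}) :
  \sum_(e in (A :\: B) :|: (B :\: A)) F e =
  \sum_(e in A) F e + \sum_(e in B) (if e \in A then - F e else F e).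
Proof.
rewrite big_mkcond [X in _ = X + _]big_mkcond [X in _ = _ + X]big_mkcond /=.
rewrite -big_split /=; apply: eq_bigr => e _; rewrite !inE.
by case: (e \in A); case: (e \in B); rewrite /= ?subrr ?addr0 ?add0r.
Qed.

Lemma big_uniq_set (T : finType) (M : nmodType) (F : T -> M) (s : seq T) :
  uniq s -> \sum_(e <- s) F e = \sum_(e in [set e in s]) F e.
Proof.
by move=> us; rewrite (big_uniq _ us); apply: eq_bigl => e; rewrite /= inE.
Qed.

(** Path families and edge sequences form infinite types; a minimum exists because on [Q] the value
    [f x] depends only on [h x], which lies in a finite type. *)
Lemma exists_minimizer (R : realType) (X : Type) (T : finType) (h : X -> T)
    (Q : X -> Prop) (f : X -> R) :
  (forall x y, Q x -> Q y -> h x = h y -> f x = f y) ->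
  (exists x, Q x) -> exists2 x, Q x & forall y, Q y -> f x <= f y.
Proof.
move=> fh [x0 Qx0].
pose S t := `[< exists2 x, Q x & h x = t >].
pose g t := if pselect (exists2 x, Q x & h x = t) is left xP
            then f (projT1 (cid2 xP)) else 0.
have gE x : Q x -> g (h x) = f x.
  move=> Qx; rewrite /g; case: pselect => [xP|[]]; last by exists x.
  by case: (cid2 xP) => y /= Qy; exact: fh.
have Sx0 : S (h x0) by apply/asboolP; exists x0.
case: (arg_minP g Sx0) => t /asboolP[x Qx <-] tmin.
exists x => // y Qy; rewrite -!gE //; apply: tmin.
by apply/asboolP; exists y.
Qed.

(** * Simple cycles in balanced arc sets *)

Section Netflow.
Variables (V E : finType) (tl hd : E -> V).
Implicit Types (X Y : {set E}) (O : seq E).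

(** Out-degree minus in-degree. Abstract [tl] and [hd] let it serve both the input graph and the
    residual graph, where parallel edges may occur. *)
Definition netflow X v : int :=
  \sum_(e in X) ((tl e == v)%:R - (hd e == v)%:R).

Lemma sum_closed_walk (M : zmodType) (F : V -> M) O :
  cycle (fun e f => hd e == tl f) O ->
  \sum_(e <- O) F (tl e) = \sum_(e <- O) F (hd e).
Proof.
have walk e s : path (fun e f => hd e == tl f) e s ->
    \sum_(f <- s) F (tl f) + F (hd (last e s)) =
    F (hd e) + \sum_(f <- s) F (hd f).
  elim: s e => [|f s IHs] e /=; first by rewrite !big_nil addr0 add0r.
  by case/andP=> /eqP ef /IHs; rewrite !big_cons -addrA => ->; rewrite ef.
case: O => [|e s] /=; first by rewrite !big_nil.
move=> /walk; rewrite last_rcons addrC => /addrI.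
by rewrite -cats1 !big_cat !big_seq1 !big_cons /= addrC => ->; rewrite addrC.
Qed.

Lemma netflow_cycle O v :
  cycle (fun e f => hd e == tl f) O -> uniq (map tl O) ->
  netflow [set e in O] v = 0.
Proof.
move=> cO /map_uniq uO; rewrite /netflow -big_uniq_set // sumrB.
by rewrite (sum_closed_walk (fun u => (u == v)%:R) cO) subrr.
Qed.

Lemma netflowD X Y v : Y \subset X ->
  netflow (X :\: Y) v = netflow X v - netflow Y v.
Proof.
move=> YX; rewrite /netflow [X in _ = X - _](big_setID Y) /=.
by rewrite (setIidPr YX) addrC addrK.
Qed.

(** Balance gives every arc of [X] a successor in [X]; following one fixed successor per vertex must
    run into a loop, which visits each of its vertices once. *)
Lemma ex_simple_cycle X e : e \in X -> (forall v, netflow X v = 0) ->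
  exists O, [/\ O != [::], {subset O <= X},
    cycle (fun e f => hd e == tl f) O & uniq (map tl O)].
Proof.
move=> eX bal.
(* The default [e] is never reached along the walk, which only visits heads of arcs of [X]. *)
pose out v := odflt e [pick f in X | tl f == v].
pose nxt v := hd (out v).
have outP f : f \in X -> (out (hd f) \in X) && (tl (out (hd f)) == hd f).
  move=> fX; rewrite /out; case: pickP => [g /andP[-> /eqP->]|noout].
    by rewrite eqxx.
  (* If no arc left [hd f], then [f] would contribute -1 there and every other arc at most 0. *)
  have := bal (hd f); rewrite /netflow (bigD1 f) //= eqxx.
  have -> : (tl f == hd f) = false by have := noout f; rewrite fX.
  rewrite sub0r => /eqP; rewrite addrC subr_eq0 => /eqP le0.
  have : \sum_(i in X | i != f) ((tl i == hd f)%:R - (hd i == hd f)%:R)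
       <= 0 :> int.
    apply: sumr_le0 => g /andP[gX _]; have := noout g; rewrite /= gX /= => ->.
    by rewrite sub0r oppr_le0 ler0n.
  by rewrite le0.
pose x n := iter n nxt (hd e).
have xP n : (out (x n) \in X) && (tl (out (x n)) == x n).
  by elim: n => [|n /andP[IHn _]]; [exact: outP|exact: (outP _ IHn)].
have /trajectP[i ltin xi] := looping_order nxt (hd e).
have cyc : fcycle nxt (orbit nxt (x i)).
  (* Iterate number [order nxt (hd e)] equals [x i], so the difference of indices is a positive
     return time; the criterion counts [k.+1] steps, hence the predecessor. *)
  apply/(orbitPcycle 0%N 3%N); exists (order nxt (hd e) - i).-1.
  by rewrite prednK ?subn_gt0 // -iterD subnK // ltnW.
have outE v : v \in orbit nxt (x i) -> (out v \in X) && (tl (out v) == v).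
  rewrite -fconnect_orbit => /iter_findex <-.
  by rewrite /x -iterD; exact: xP.
have tlK : map tl (map out (orbit nxt (x i))) = orbit nxt (x i).
  by rewrite -map_comp -[RHS]map_id; apply/eq_in_map => v /outE/andP[_ /eqP].
exists (map out (orbit nxt (x i))); split.
- by rewrite /orbit -orderSpred.
- by move=> _ /mapP[v /outE/andP[vX _] ->].
- rewrite cycle_map; apply: (@sub_in_cycle _ (mem (orbit nxt (x i)))) cyc.
    by move=> u v _ /outE/andP[_ /eqP tlv]; rewrite /= tlv.
  exact/allP.
- by rewrite tlK orbit_uniq.
Qed.
End Netflow.

(** * Decomposition of a flow into arc-disjoint paths *)

Section FlowDecomposition.
Variables (V : finType) (s t : V).
Implicit Types (F : {set V * V}) (p : seq V).
Notation flow := (netflow fst snd).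
Notation arcs p := (zip (s :: p) p).

Lemma uniq_arcs (u : V) p : uniq p -> uniq (zip (u :: p) p).
Proof.
move=> up; apply: (@map_uniq _ _ snd).
by rewrite -/(unzip2 _) unzip2_zip //= leqnSn.
Qed.

Lemma path_arcs F (u : V) p :
  path (fun u v => (u, v) \in F) u p = all [in F] (zip (u :: p) p).
Proof. by elim: p u => //= v p IHp u; rewrite IHp. Qed.

Lemma netflow_path p v : uniq p ->
  flow [set e in arcs p] v = (s == v)%:R - (last s p == v)%:R.
Proof.
move=> up; rewrite /netflow -big_uniq_set ?uniq_arcs // => {up}.
elim: p s => [|w p IHp] u /=; first by rewrite big_nil subrr.
by rewrite big_cons IHp /= addrA subrK.
Qed.

(** Cut argument: no arc of [F] leaves the set [S] of vertices reachable from [s], so the net flow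
    out of [S] is at most 0; if [t] were outside [S] it would be [k.+1]. *)
Lemma flow_path F k :
  (forall v, flow F v = k.+1%:R * ((s == v)%:R - (t == v)%:R)) ->
  exists p, [/\ path (fun u v => (u, v) \in F) s p, last s p = t
              & uniq (s :: p)].
Proof.
move=> flowF.
pose S := [set v | connect (fun u v => (u, v) \in F) s v].
have inS a : \sum_(v in S) (a == v)%:R = (a \in S)%:R :> int.
  have [aS|aS] := boolP (a \in S); last first.
    by rewrite big1 // => v vS; case: eqP aS => // ->; rewrite vS.
  rewrite (bigD1 a) //= eqxx big1 ?addr0 // => v /andP[_ /negPf].
  by rewrite eq_sym => ->.
have [|tS] := boolP (t \in S).
  rewrite inE => /connectP[p sp tp].
  by case/shortenP: sp tp => q sq uq _ ->; exists q.
have sS : s \in S by rewrite inE connect0.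
have : \sum_(v in S) flow F v = k.+1%:R.
  rewrite (eq_bigr _ (fun v _ => flowF v)) -mulr_sumr sumrB !inS sS (negPf tS).
  by rewrite subr0 mulr1.
rewrite exchange_big /= => sumF.
suff : \sum_(e in F) \sum_(v in S) ((e.1 == v)%:R - (e.2 == v)%:R) <= 0 :> int.
  by rewrite sumF lern0.
apply: sumr_le0 => -[u w] uwF; rewrite sumrB !inS /= subr_le0 ler_nat.
have [uS|//] := boolP (u \in S); rewrite lt0b.
by move: uS; rewrite !inE => /connect_trans; apply; exact: connect1.
Qed.

(** Each induction step peels off a path carrying one unit; the balanced arcs left at the end are
    dropped. *)
Lemma flow_decomposition k F :
  (forall v, flow F v = k%:R * ((s == v)%:R - (t == v)%:R)) ->
  exists P : 'I_k -> seq V,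
    (forall i, [&& path (fun u v => (u, v) \in F) s (P i), last s (P i) == t
                & uniq (s :: P i)]) /\
    (forall i j, i != j -> [disjoint arcs (P i) & arcs (P j)]).
Proof.
elim: k F => [|k IHk] F flowF; first by exists (fun=> [::]); split => -[].
have [p [pF pt up]] := flow_path flowF.
have subp : [set e in arcs p] \subset F.
  by apply/subsetP => e; rewrite inE; move: e; apply/allP; rewrite -path_arcs.
have /IHk[P [PF Pdis]] v : flow (F :\: [set e in arcs p]) v =
    k%:R * ((s == v)%:R - (t == v)%:R).
  rewrite netflowD // flowF netflow_path; last by case/andP: up.
  by rewrite pt -[k.+1]addn1 natrD mulrDl mul1r addrK.
have sub i e : e \in arcs (P i) -> e \in F :\: [set e in arcs p].
  by move: e; apply/allP; rewrite -path_arcs; case/and3P: (PF i).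
have disp i : [disjoint arcs p & arcs (P i)].
  rewrite disjoint_sym disjoint_subset; apply/subsetP => e /sub.
  by rewrite !inE => /andP[].
exists (fun i => if unlift ord0 i is Some j then P j else p); split=> [i|i j].
  case: unliftP => [j _|_]; last by rewrite pF pt eqxx.
  have /and3P[_ -> ->] := PF j; rewrite !andbT path_arcs.
  by apply/allP => e /sub; rewrite inE => /andP[].
case: unliftP => [i' ->|->]; case: unliftP => [j' ->|->] //.
- by move=> ne; apply: Pdis; apply: contraNneq ne => ->.
- by move=> _; rewrite disjoint_sym; exact: disp.
Qed.
End FlowDecomposition.

(** * Path families and their residual graphs *)

Section Instance.
Variable I : kBCP.
Implicit Types (P Q : path_family I) (X : {set vertex I * vertex I}).
Implicit Types (O : seq (vertex I * vertex I)).

Lemma sum_used_edges (M : nmodType) (F : vertex I * vertex I -> M) P :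
  disjoint_stpaths P ->
  \sum_(e in used_edges P) F e =
  \sum_(i < npaths I) \sum_(e <- path_edges (tnth P i)) F e.
Proof.
case=> stP disP.
have -> : used_edges P = \bigcup_i [set e in path_edges (tnth P i)].
  apply/setP => e; rewrite inE; apply/existsP/bigcupP => -[i].
    by move=> ei; exists i; rewrite ?inE.
  by rewrite inE => _ ei; exists i.
rewrite partition_disjoint_bigcup => [|i j /disP]; last first.
  rewrite !disjoint_subset => /subsetP dis; apply/subsetP => e.
  by rewrite !inE => /dis; rewrite !inE.
apply: eq_bigr => i _; have /and3P[_ _ /andP[_ ui]] := stP i.
by rewrite -big_uniq_set // uniq_arcs.
Qed.

Lemma used_edges_sub P : disjoint_stpaths P -> used_edges P \subset edges I.
Proof.
case=> stP _; apply/subsetP => e; rewrite inE => /existsP[i]; move: e.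
by apply/allP; rewrite -path_arcs; case/and3P: (stP i).
Qed.

Lemma netflow_used P v : disjoint_stpaths P ->
  netflow fst snd (used_edges P) v =
  (npaths I)%:R * ((source I == v)%:R - (target I == v)%:R).
Proof.
move=> disP; rewrite /netflow sum_used_edges //.
rewrite mulr_natl -[in RHS](card_ord (npaths I)) -sumr_const.
apply: eq_bigr => i _; have /and3P[_ /eqP <- /andP[_ ui]] := disP.1 i.
by rewrite -netflow_path // /netflow -big_uniq_set // uniq_arcs.
Qed.

(** Deleting a used edge changes the net flow exactly as adding its reversed copy does. *)
Lemma netflow_residual P X v :
  netflow fst snd ((used_edges P :\: X) :|: (X :\: used_edges P)) v =
  netflow fst snd (used_edges P) v + netflow (res_tail P) (res_head P) X v.
Proof.
rewrite /netflow sum_symdiff; congr (_ + _); apply: eq_bigr => e _.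
by rewrite /res_tail /res_head; case: ifP; rewrite ?opprB.
Qed.

Definition symdiff X Y := (X :\: Y) :|: (Y :\: X).

Lemma symdiffK X Y : symdiff X (symdiff X Y) = Y.
Proof.
by apply/setP => e; rewrite !inE; case: (e \in X); case: (e \in Y).
Qed.

(** Toggling this set turns the used edges of [P] into those of [Q], which have the same net flow,
    so its residual contribution vanishes. *)
Lemma symdiff_balanced P Q v : disjoint_stpaths P -> disjoint_stpaths Q ->
  netflow (res_tail P) (res_head P) (symdiff (used_edges P) (used_edges Q)) v
  = 0.
Proof.
move=> disP disQ; have := netflow_residual P _ v.
move=> /(_ (symdiff (used_edges P) (used_edges Q))).
rewrite -/(symdiff _ _) symdiffK !netflow_used // => /eqP.
by rewrite -subr_eq0 opprD addrA subrr sub0r oppr_eq0 => /eqP.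
Qed.

(** A residual cycle is balanced, so the exchanged edges still carry [npaths I] units from source to
    target. *)
Lemma exchange_exists P O : disjoint_stpaths P -> res_cycle P O ->
  exists P', exchange P O P'.
Proof.
move=> disP /and4P[_ EO cO uO].
have flow v : netflow fst snd (exchange_edges P O) v =
    (npaths I)%:R * ((source I == v)%:R - (target I == v)%:R).
  by rewrite netflow_residual netflow_used // netflow_cycle ?addr0.
have [p [pF pdis]] := flow_decomposition flow.
have pE i e : e \in zip (source I :: p i) (p i) -> e \in exchange_edges P O.
  by move: e; apply/allP; rewrite -path_arcs; case/and3P: (pF i).
exists [tuple p i | i < npaths I]; split; last first.
  apply/subsetP => e; rewrite inE => /existsP[i].
  by rewrite tnth_mktuple; exact: pE.
split=> [i|i j]; rewrite !tnth_mktuple; last exact: pdis.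
have /and3P[_ pt up] := pF i; rewrite /stpath pt up !andbT path_arcs.
apply/allP => e /pE; rewrite in_setU !in_setD inE => /orP[|] /andP[].
  by move=> _ eP; exact: (subsetP (used_edges_sub disP)).
by move=> _; exact: (allP EO).
Qed.

Lemma res_cycle_uniq P O : res_cycle P O -> uniq O.
Proof. by case/and4P => _ _ _ /map_uniq. Qed.

(** * Cost and delay, and their change under an exchange *)

Section Residual.
Variable R : realType.

Lemma total_costE P : disjoint_stpaths P ->
  (total_cost P)%:R = \sum_(e in used_edges P) (cost e)%:R :> R.
Proof.
move=> disP; rewrite sum_used_edges // natr_sum.
by apply: eq_bigr => i _; rewrite natr_sum.
Qed.

Lemma total_delayE P : disjoint_stpaths P ->
  (total_delay P)%:R = \sum_(e in used_edges P) (delay e)%:R :> R.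
Proof.
move=> disP; rewrite sum_used_edges // natr_sum.
by apply: eq_bigr => i _; rewrite natr_sum.
Qed.

Lemma weightE P : weight R P =
  (total_cost P)%:R / (cost_bound I)%:R +
  (total_delay P)%:R / (delay_bound I)%:R.
Proof.
rewrite /weight !natr_sum !mulr_suml -big_split; apply: eq_bigr => i _ /=.
by rewrite !natr_sum !mulr_suml -big_split.
Qed.

Lemma ex_min_sum : (exists P, disjoint_stpaths P) -> exists P, min_sum R P.
Proof.
move=> exP; have [|P disP minP] := exists_minimizer (h := used_edges (I := I))
  (f := weight R (I := I)) _ exP; last by exists P.
move=> P Q disP disQ PQ.
by rewrite !weightE !total_costE // !total_delayE // PQ.
Qed.

Lemma min_sum_le2 P : (exists Q, feasible Q) -> min_sum R P ->
  (total_cost P)%:R / (cost_bound I)%:R +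
  (total_delay P)%:R / (delay_bound I)%:R
  <= 2 :> R.
Proof.
move=> [Q [disQ cQ dQ]] [_ /(_ _ disQ)]; rewrite !weightE => /le_trans; apply.
have C0 : 0 < (cost_bound I)%:R :> R by rewrite ltr0n cost_bound_gt0.
have D0 : 0 < (delay_bound I)%:R :> R by rewrite ltr0n delay_bound_gt0.
by rewrite -[2]/(1 + 1 : R) lerD // ler_pdivrMr // mul1r ler_nat.
Qed.

(** Only an inequality, because exchanged edges left out of [P'] have nonnegative delay. *)
Lemma exchange_delay P O P' : disjoint_stpaths P -> res_cycle P O ->
  exchange P O P' ->
  (total_delay P')%:R <= (total_delay P)%:R + res_delay R P O.
Proof.
move=> disP /res_cycle_uniq uO [disP' subP']; rewrite !total_delayE //.
rewrite /res_delay big_uniq_set // -sum_symdiff -/(exchange_edges P O).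
rewrite [leRHS](big_setID (used_edges P')) /= (setIidPr subP').
by rewrite lerDl sumr_ge0.
Qed.

(** Negative delay forces [O] to use a reversed edge; its removal saves a cost of at least 1, which
    [res_cost 0] does not credit. *)
Lemma exchange_cost P O P' : disjoint_stpaths P -> eligible_cycle R P O ->
  exchange P O P' ->
  (total_cost P')%:R <= (total_cost P)%:R + res_cost (0 : R) P O - 1.
Proof.
move=> disP [cycO _ dO] [disP' subP']; have uO := res_cycle_uniq cycO.
have [e eO eP] : exists2 e, e \in O & e \in used_edges P.
  apply/hasP; apply: contraTT dO => /hasPn noP; rewrite -leNgt /res_delay.
  by rewrite big_seq sumr_ge0 // => e /noP /negPf ->.
have /le_trans -> // : (total_cost P')%:R <= (total_cost P)%:R +
    \sum_(e <- O)
      (if e \in used_edges P then - (cost e)%:R else (cost e)%:R) :> R.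
  rewrite !total_costE // big_uniq_set // -sum_symdiff -/(exchange_edges P O).
  rewrite [leRHS](big_setID (used_edges P')) /= (setIidPr subP').
  by rewrite lerDl sumr_ge0.
rewrite -addrA lerD2l /res_cost (bigD1_seq e) //=.
rewrite [X in _ <= X - 1](bigD1_seq e) //= eP add0r addrC lerD //.
  apply: ler_sum => f _; case: ifP => _ //.
  by rewrite oppr_le0.
rewrite lerN2 ler1n cost_gt0 //.
exact: (subsetP (used_edges_sub disP)).
Qed.

(** * The best cycle ratio against a feasible solution *)

Variable eps : R.
Hypothesis eps0 : 0 < eps.

(* The cycles into which [X] decomposes all meet the budget, because their
   costs add up to that of [X]. *)
Lemma balanced_ratio P X r : r <= 0 ->
  (forall O, eligible_cycle R P O ->
     r * res_cost eps P O <= res_delay R P O) ->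
  X \subset edges I ->
  (forall v, netflow (res_tail P) (res_head P) X v = 0) ->
  res_cost (0 : R) P (enum X) <= (cost_bound I)%:R ->
  r * res_cost eps P (enum X) <= res_delay R P (enum X).
Proof.
move=> r0 ratio; have [n] := ubnP #|X|; elim: n X => // n IHn X leX XE bal.
have [->|[e eX]] := set_0Vmem X.
  by rewrite enum_set0 /res_cost /res_delay !big_nil mulr0.
have [O [O0 OX cO uO]] := ex_simple_cycle eX bal.
have {}OX : [set e in O] \subset X by apply/subsetP => f; rewrite inE => /OX.
have split (F : vertex I * vertex I -> R) : \sum_(f <- enum X) F f =
    \sum_(f <- O) F f + \sum_(f <- enum (X :\: [set e in O])) F f.
  rewrite !big_enum /= (big_setID [set e in O]) /= (setIidPr OX).
  by rewrite [in RHS]big_uniq_set // (map_uniq uO).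
have ge0 (d : R) s : 0 <= d -> 0 <= res_cost d P s :> R.
  by move=> d0; apply: sumr_ge0 => f _; case: ifP.
have cycO : res_cycle P O.
  apply/and4P; split => //; apply/allP => f fO.
  by apply: (subsetP XE); apply: (subsetP OX); rewrite inE.
rewrite /res_cost !split -/(res_cost _ _ _) -/(res_cost _ _ _) => leC.
rewrite /res_delay split -/(res_delay _ _ _) -/(res_delay _ _ _) mulrDr lerD //.
  (* A cycle of nonnegative delay satisfies the inequality because [r <= 0]. *)
  have [dO|dO] := ltP (res_delay R P O) 0.
    by apply: ratio; split => //; apply: le_trans leC; rewrite lerDl ge0.
  by apply: le_trans dO; apply: mulr_le0_ge0 => //; exact: ge0 (ltW eps0).
apply: IHn.
- rewrite ltnS in leX; apply: leq_trans leX.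
  rewrite -(cardsID [set e in O] X) (setIidPr OX) -[X in (X < _)%N]add0n.
  rewrite ltn_add2r card_gt0; apply/set0Pn.
  by case: (O) O0 => // f s _; exists f; rewrite inE mem_head.
- exact: subset_trans (subsetDl _ _) XE.
- by move=> v; rewrite netflowD // bal netflow_cycle // subrr.
- by apply: le_trans leC; rewrite lerDr ge0.
Qed.

Lemma res_cost_symdiff (d : R) P Q : 0 <= d ->
  disjoint_stpaths P -> disjoint_stpaths Q ->
  res_cost d P (enum (symdiff (used_edges P) (used_edges Q))) <=
  (total_cost Q)%:R + d * #|edges I|%:R.
Proof.
move=> d0 disP disQ; rewrite total_costE // mulr_natr -sumr_const.
rewrite /res_cost big_enum /= big_mkcond [X in _ <= X + _]big_mkcond.
rewrite [X in _ <= _ + X]big_mkcond -big_split /=.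
apply: ler_sum => e _; rewrite in_setU !in_setD.
have := subsetP (used_edges_sub disP) e.
case: (e \in used_edges P) => [->//|_];
  case: (e \in used_edges Q); case: (e \in edges I);
  by rewrite /= ?addr0 ?add0r ?addr_ge0 ?ler0n ?lerDl.
Qed.

Lemma res_delay_symdiff P Q : disjoint_stpaths P -> disjoint_stpaths Q ->
  res_delay R P (enum (symdiff (used_edges P) (used_edges Q))) =
  (total_delay Q)%:R - (total_delay P)%:R.
Proof.
move=> disP disQ; rewrite /res_delay big_enum !total_delayE //=.
rewrite -[in RHS](symdiffK (used_edges P) (used_edges Q)).
by rewrite [in RHS]sum_symdiff addrC addKr.
Qed.

(** [balanced_ratio] applied to the difference of [P] and [Q]; as [r <= 0], the upper bound on its
    cost can replace the cost itself. *)
Lemma symdiff_ratio P Q r : r <= 0 -> disjoint_stpaths P -> feasible Q ->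
  (forall O, eligible_cycle R P O ->
     r * res_cost eps P O <= res_delay R P O) ->
  r * ((cost_bound I)%:R + eps * #|edges I|%:R)
  <= (delay_bound I)%:R - (total_delay P)%:R.
Proof.
move=> r0 disP [disQ cQ dQ] /(balanced_ratio r0) ratio.
apply: le_trans (_ : (total_delay Q)%:R - (total_delay P)%:R <= _); last first.
  by rewrite lerD2r ler_nat.
rewrite -res_delay_symdiff //; apply: le_trans (ratio _ _ _ _).
- rewrite ler_wnM2l // (le_trans (res_cost_symdiff (ltW eps0) disP disQ)) //.
  by rewrite lerD2r ler_nat.
- rewrite subUset !(subset_trans (subsetDl _ _)) //; exact: used_edges_sub.
- by move=> v; exact: symdiff_balanced.
- rewrite (le_trans (res_cost_symdiff (lexx 0) disP disQ)) // mul0r addr0.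
  by rewrite ler_nat.
Qed.

Lemma res_cost_gt0 P O : res_cycle P O -> 0 < res_cost eps P O.
Proof.
move=> /and4P[+ /allP OE _ _]; case: O OE => // e O OE _.
have pos f : f \in e :: O ->
    0 < (if f \in used_edges P then eps else (cost f)%:R).
  by move=> /OE fE; case: ifP => // _; rewrite ltr0n cost_gt0.
rewrite /res_cost big_cons ltr_wpDr ?pos ?mem_head // big_seq.
by apply: sumr_ge0 => f fO; rewrite ltW // pos // inE fO orbT.
Qed.

Lemma best_cycle_exists P : disjoint_stpaths P -> (exists Q, feasible Q) ->
  (delay_bound I < total_delay P)%N -> exists O, best_cycle eps P O.
Proof.
move=> disP [Q feasQ] dP.
have exel : exists O, eligible_cycle R P O.
  apply: contrapT => noel.
  (* Without eligible cycles the ratio hypothesis holds vacuously for [r = 0], and the conclusion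
     would give d(P) <= D. *)
  have := symdiff_ratio (lexx 0) disP feasQ; rewrite mul0r subr_ge0 ler_nat.
  rewrite leqNgt dP => imp; suff : false by [].
  by apply: imp => O elO; case: noel; exists O.
have [|O elO minO] := exists_minimizer (h := fun O => [set e in O])
  (f := fun O => res_delay R P O / res_cost eps P O) _ exel; last by exists O.
move=> O O' [/res_cycle_uniq uO _ _] [/res_cycle_uniq uO' _ _] OO'.
by rewrite /res_delay /res_cost !big_uniq_set // OO'.
Qed.

(** The ratio of the best cycle is an admissible [r] in [symdiff_ratio]; the [eps] terms in the cost
    of [O] can then be dropped because D - d(P) <= 0. *)
Lemma best_cycle_ratio P O : disjoint_stpaths P -> (exists Q, feasible Q) ->
  (delay_bound I <= total_delay P)%N -> best_cycle eps P O ->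
  ((total_delay P)%:R - (delay_bound I)%:R) * res_cost (0 : R) P O
  <= - res_delay R P O * ((cost_bound I)%:R + eps * #|edges I|%:R).
Proof.
move=> disP [Q feasQ] dP [[cycO cO dO] best].
have c0 := res_cost_gt0 cycO.
have r0 : res_delay R P O / res_cost eps P O <= 0.
  by rewrite ler_pdivrMr // mul0r ltW.
have := symdiff_ratio r0 disP feasQ.
have ratio O' : eligible_cycle R P O' ->
    res_delay R P O / res_cost eps P O * res_cost eps P O' <= res_delay R P O'.
  by move=> elO'; rewrite -ler_pdivlMr ?best // res_cost_gt0 //; case: elO'.
move=> /(_ ratio); rewrite mulrAC ler_pdivrMr // mulNr lerNr -mulNr opprB.
move=> /le_trans; apply; rewrite ler_wnM2l ?subr_le0 ?ler_nat //.
by apply: ler_sum => e _; case: ifP => // _; exact: ltW.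
Qed.

(** * The logarithmic cost bound and termination of the loop *)

(** Follows from [1 - z <= expR (- z)]. *)
Lemma ln_contraction (y y' z : R) : 0 < y -> 0 < y' -> y' <= y * (1 - z) ->
  z <= ln y - ln y'.
Proof.
move=> y0 y'0 yy'; rewrite lerBrDr addrC -lerBrDr -[- z]expRK.
rewrite -lnM ?posrE ?expR_gt0 //.
rewrite ler_ln ?posrE ?mulr_gt0 ?expR_gt0 //; apply: le_trans yy' _.
by rewrite ler_wpM2l ?expR_ge1Dx // ltW.
Qed.

Variable beta : R.
Hypothesis beta0 : 0 < beta.
Hypothesis eps_small : eps * #|edges I|%:R * (delay_bound I)%:R <= 1.
Hypothesis feas : exists Q : path_family I, feasible Q.
Notation C := ((cost_bound I)%:R : R).
Notation D := ((delay_bound I)%:R : R).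
Notation C' := (C + eps * #|edges I|%:R).
Notation excess P := (((total_delay P)%:R - D) / D).
Notation Post := (fun Q => [/\ disjoint_stpaths Q,
  (total_delay Q)%:R <= (1 + beta) * D
  & (total_cost Q)%:R <= Num.max 2 (1 + ln (1 / beta)) * C]).

Let C0 : 0 < C. Proof. by rewrite ltr0n cost_bound_gt0. Qed.
Let D0 : 0 < D. Proof. by rewrite ltr0n delay_bound_gt0. Qed.
Let m0 : 0 <= eps * #|edges I|%:R. Proof. by rewrite mulr_ge0 // ltW. Qed.

Lemma excess_gt P : (1 + beta) * D < (total_delay P)%:R -> beta < excess P.
Proof. by move=> dP; rewrite ltr_pdivlMr //; lra. Qed.

(** The invariant has two halves: the final cost bound for families that stop, the logarithmic one
    for those that iterate. Every exchange lowers the integer delay, hence the induction on it. *)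
Lemma loop_returnsP P : disjoint_stpaths P ->
  ((total_delay P)%:R <= (1 + beta) * D ->
     (total_cost P)%:R <= Num.max 2 (1 + ln (1 / beta)) * C) ->
  ((1 + beta) * D < (total_delay P)%:R ->
     (total_cost P)%:R <= - C' * ln (excess P)) ->
  loop_returns beta eps Post P.
Proof.
have [n] := ubnP (total_delay P); elim: n P => // n IHn P ltPn disP small large.
have [dP|dP] := leP (total_delay P)%:R ((1 + beta) * D).
  by apply: LoopReturn => //; split => //; exact: small.
have {small}cP := large dP; have ybeta := excess_gt dP.
have DP : (delay_bound I < total_delay P)%N.
  rewrite -(ltr_nat R); apply: le_lt_trans dP.
  by rewrite ler_peMl ?ler0n // lerDl ltW.
apply: LoopIterate => //.
- exact: best_cycle_exists.
- by move=> O [[cycO _ _] _]; exact: exchange_exists.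
move=> O P' bestO exP'; have [elO _] := bestO; have [cycO cO dO] := elO.
have dP' := exchange_delay disP cycO exP'.
have cP' := exchange_cost disP elO exP'.
have ratio := best_cycle_ratio disP feas (ltnW DP) bestO.
have y0 : 0 < excess P by exact: lt_trans ybeta.
apply: IHn => [||dP'le|dP'gt].
- by rewrite -ltnS (leq_trans _ ltPn) // ltnS -(ltr_nat R); lra.
- by case: exP'.
- apply: le_trans (_ : (1 + ln (1 / beta)) * C <= _); last first.
    by rewrite ler_pM2r // le_max lexx orbT.
  have lnbeta : - ln (excess P) <= ln (1 / beta).
    by rewrite div1r lnV ?posrE // lerN2 ler_ln ?posrE // ltW.
  (* With y the excess, ln (1 / y) < 1 / y = D / (d(P) - D), whose denominator is at least 1. *)
  have lnD : - ln (excess P) <= D.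
    rewrite -lnV ?posrE //; apply: ltW; apply: lt_le_trans (ln_sublinear _) _.
      by rewrite invr_gt0.
    rewrite invf_div ler_pdivrMr ?subr_gt0 ?ltr_nat // ler_peMr ?ler0n //.
    by rewrite lerBrDl natr1 ler_nat.
  (* Here c(P') <= C' ln (1 / y) + C - 1, and the [eps] part of [C'] contributes at most 1. *)
  have := ler_wpM2l (ltW C0) lnbeta; have := ler_wpM2l m0 lnD.
  by move: eps_small cP cP' cO; lra.
- have y'0 : 0 < excess P' by apply: lt_trans (excess_gt dP'gt).
  have C'0 : 0 < C' by rewrite ltr_wpDr.
  have /(ln_contraction y0 y'0) : excess P' <=
      excess P * (1 - res_cost (0 : R) P O / C').
    rewrite mulrAC ler_pM2r ?invr_gt0 // mulrBr mulr1 mulrA.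
    have : ((total_delay P)%:R - D) * res_cost (0 : R) P O / C'
      <= - res_delay R P O by rewrite ler_pdivrMr.
    by lra.
  by rewrite ler_pdivrMr //; lra.
Qed.

Lemma min_sum_excess P : min_sum R P ->
  (1 + beta) * D < (total_delay P)%:R ->
  (total_cost P)%:R <= - C' * ln (excess P).
Proof.
move=> minP dP; have := min_sum_le2 feas minP.
have y0 : 0 < excess P := lt_trans beta0 (excess_gt dP).
have -> : (total_delay P)%:R / D = 1 + excess P.
  by rewrite mulrBl divff ?gt_eqF // addrC subrK.
move=> le2; have cy : (total_cost P)%:R <= C * (1 - excess P).
  by rewrite mulrC -ler_pdivrMr //; lra.
have lny : ln (excess P) <= excess P - 1.
  by rewrite -{1}(subrK 1 (excess P)) addrC le_ln1Dx //; lra.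
(* Nonnegative cost forces this; then the logarithm is nonpositive and [C] may be raised to [C']. *)
have y1 : excess P <= 1.
  by rewrite -subr_ge0 -(pmulr_rge0 _ C0) (le_trans _ cy).
have lny0 : ln (excess P) <= 0 by rewrite ln_le0.
have := ler_wpM2l (ltW C0) lny; have := mulr_ge0_le0 m0 lny0.
by lra.
Qed.
End Residual.
End Instance.

Theorem theorem2 (R : realType) (beta : R) (hbeta0 : 0 < beta)
    (hbeta1 : beta <= 1) (I : kBCP) (eps : R) (heps0 : 0 < eps)
    (heps1 : eps < 1 / (#|edges I| * #|vertex I| * delay_bound I)%N%:R)
    (hfeas : exists P : path_family I, feasible P) :
  algorithm2_returns beta eps (fun Q : path_family I =>
    [/\ disjoint_stpaths Q,
        (total_delay Q)%:R <= (1 + beta) * (delay_bound I)%:R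
      & (total_cost Q)%:R
          <= Num.max 2 (1 + ln (1 / beta)) * (cost_bound I)%:R]).
Proof.
have eps_small : eps * #|edges I|%:R * (delay_bound I)%:R <= 1.
  have n0 : (0 < #|vertex I|)%N by apply/card_gt0P; exists (source I).
  (* Without edges the bound on [eps] reads [1 / 0], which is 0 by convention, so this case is
     separate. *)
  have [m0|m0] := posnP #|edges I|; first by rewrite m0 mulr0 mul0r ler01.
  have D0 := delay_bound_gt0 I.
  move: heps1; rewrite ltr_pdivlMr ?ltr0n ?muln_gt0 ?m0 ?n0 // => /ltW.
  apply: le_trans; rewrite -mulrA -natrM ler_pM2l // ler_nat leq_pmul2r //.
  exact: leq_pmulr.
split=> [|P minP].
  by apply: ex_min_sum; case: hfeas => Q []; exists Q.
apply: loop_returnsP => //; first by case: minP.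
  (* If the initial family is returned at once, weight at most 2 alone gives cost at most 2C: the
     source of the 2 in the maximum. *)
  move=> dP; have := min_sum_le2 hfeas minP.
  have C0 : 0 < (cost_bound I)%:R :> R by rewrite ltr0n cost_bound_gt0.
  have dD : 0 <= (total_delay P)%:R / (delay_bound I)%:R :> R.
    by rewrite divr_ge0.
  move=> le2; apply: le_trans (_ : 2 * (cost_bound I)%:R <= _).
    by rewrite -ler_pdivrMr //; lra.
  by rewrite ler_pM2r // le_max lexx.
exact: min_sum_excess.
Qed.
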